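(* Let $X$ be a set, and let $(F/N',\star,\circ)$ be the commutative wire constructed from $X$ in the context. The free commutative skew brace generated by $X$ can be described as the set of fractions $\frac{u}{v}$ with $u,v\in F/N'$, with relation $$\frac{u}{v}=\frac{u_1}{v_1}\quad\text{if and only if}\quad u\circ v_1=v\circ u_1,$$ and with operations $$\frac{u}{v}\star\frac{u_1}{v_1}=\frac{(u\circ v_1)\star (v\circ v_1)^{-1}\star (v\circ u_1)}{v\circ v_1}\qquad\text{and}\qquad \frac{u}{v}\circ\frac{u_1}{v_1}=\frac{u\circ u_1}{v\circ v_1}.$$
   Context: A skew brace is a triple $(B,\star,\circ)$ such that $(B,\star)$ and $(B,\circ)$ are groups and $a\circ(b\star c)=(a\circ b)\star a^{-1}\star(a\circ c)$ for all $a,b,c$, where $a^{-1}$ is the inverse with respect to $\star$. It is commutative if $\circ$ is commutative. Skew brace morphisms are maps preserving $\star$ and $\circ$. The free commutative skew brace generated by $X$ is the free object on $X$ in the variety of commutative skew braces: a commutative skew brace $S$ with a map $\iota\colon X\to S$ such that every map $f\colon X\to B$ to a commutative skew brace $B$ factors as $f=\hat f\iota$ for a unique skew brace morphism $\hat f\colon S\to B$. Here the canonical map is $x\mapsto \frac{[x]}{[e]}$. A wire is a triple $(W,\star,\circ)$ with $(W,\star)$ a group, $(W,\circ)$ a semigroup, and $a\circ(b\star c)=(a\circ b)\star a^{-1}\star(a\circ c)$, $(b\star c)\circ a=(b\circ a)\star a^{-1}\star(c\circ a)$ for all $a,b,c\in W$; it is commutative if $\circ$ is commutative. Construction of $F/N'$.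 Let $Y=M_{\mathrm c}(X)$ be the free commutative semigroup (without identity) generated by $X$, with operation $\circ$. Let $F=P_{\mathrm c}(X)$ be the free group generated by the set $Y$, with operation $\star$ and neutral element $e$. Write elements of $F$ as $u=\prod_{i=1}^n u_i^{\epsilon_i}=u_1^{\epsilon_1}\star\cdots\star u_n^{\epsilon_n}$ with $u_i\in Y$, $\epsilon_i\in\{1,-1\}$ (ordered product, not necessarily reduced). For $l\in Y$ and such $u$ put $u\circ l=\left(\prod_{i=1}^n((u_i\circ l)\star l^{-1})^{\epsilon_i}\right)\star l$. For $u\in F$ and $v=\prod_{j=1}^m v_j^{\delta_j}\in F$ put $u\circ_l v=u\star\prod_{j=1}^m\left(u^{-1}\star(u\circ v_j)\right)^{\delta_j}$. These do not depend on the chosen word representatives. Let $N=P_{\mathrm c}(X)^2$ be the normal subgroup of $F$ generated by the elements $m^{-1}\star(m\circ l)\star l^{-1}$ for $m,l\in Y$, and let $N'=[N,N]$ be its commutator subgroup. Then $\star$ and $[u]\circ[v]=[u\circ_l v]$ make $F/N'$ a commutative wire. *)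

(* Defs.v *)
From HB Require Import structures.
From mathcomp Require Import all_boot.
From mathcomp Require Import finmap multiset.
From mathcomp Require Import boolp classical_sets.

Set Implicit Arguments.
Unset Strict Implicit.
Unset Printing Implicit Defensive.

Local Open Scope classical_set_scope.
Local Open Scope quotient_scope.
Local Open Scope group_scope.

(* In a groupType the library's product x * y is the operation ⋆; the second  *)
(* operation ∘ is written x \circ y.                                          *)
HB.mixin Record hasCirc T := { circ : T -> T -> T }.
HB.structure Definition CircMagma := { T of hasCirc T }.

Reserved Notation "x \circ y" (at level 40, left associativity).
Notation "x \circ y" := (circ x y) : group_scope.

HB.mixin Record isSkewBrace B of Group B & hasCirc B := {
  circ_one : B;
  circ_inv : B -> B;
  circA : associative (@circ B);
  circ1x : left_id circ_one (@circ B);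
  circx1 : right_id circ_one (@circ B);
  circVx : left_inverse circ_one circ_inv (@circ B);
  circxV : right_inverse circ_one circ_inv (@circ B);
  circ_mulr : forall a b c : B,
    a \circ (b * c) = (a \circ b) * a^-1 * (a \circ c)
}.
#[short(type="skewBraceType")]
HB.structure Definition SkewBrace := { B of isSkewBrace B & Group B & hasCirc B }.

HB.mixin Record SkewBrace_isCommutative B of SkewBrace B := {
  circC : commutative (@circ B)
}.
#[short(type="comSkewBraceType")]
HB.structure Definition ComSkewBrace :=
  { B of SkewBrace_isCommutative B & SkewBrace B }.

Definition skew_brace_morphism (B C : skewBraceType) (h : B -> C) : Prop :=
  {morph h : a b / a * b} /\ {morph h : a b / a \circ b}.

Definition free_com_skew_brace (X : Type) (S : comSkewBraceType)
    (iota : X -> S) : Prop :=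
  forall (B : comSkewBraceType) (f : X -> B),
    exists! h : S -> B, skew_brace_morphism h /\ forall x, f x = h (iota x).

Section Subgroups.
Variable G : groupType.
Implicit Types A K : set G.

Definition is_subgroup A : Prop :=
  [/\ A 1, forall x y, A x -> A y -> A (x * y) & forall x, A x -> A x^-1].

Definition is_normal_subgroup A : Prop :=
  is_subgroup A /\ forall x g, A x -> A (x ^ g).

Definition normal_closure A : set G := smallest is_normal_subgroup A.

Definition commutator_subgroup K : set G :=
  smallest is_subgroup [set [~ a, b] | a in K & b in K].

Lemma normal_closure_normal A : is_normal_subgroup (normal_closure A).
Proof.
split; first split.
- by move=> B [[[B1 _ _] _] _]; exact: B1.
- move=> x y Ax Ay B BP; have [[[_ BM _] _] _] := BP.
  by apply: BM; [apply: Ax | apply: Ay].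
- by move=> x Ax B BP; have [[[_ _ BV] _] _] := BP; apply: BV; apply: Ax.
- by move=> x g Ax B BP; have [[_ BJ] _] := BP; apply: BJ; apply: Ax.
Qed.

Lemma commutator_subgroup_subgroup K : is_subgroup (commutator_subgroup K).
Proof.
split.
- by move=> B [[B1 _ _] _]; exact: B1.
- move=> x y Ax Ay B BP; have [[_ BM _] _] := BP.
  by apply: BM; [apply: Ax | apply: Ay].
- by move=> x Ax B BP; have [[_ _ BV] _] := BP; apply: BV; apply: Ax.
Qed.

Lemma commutator_subgroup_stable K (h : G -> G) : {morph h : x y / x * y} ->
  (forall x, K x -> K (h x)) ->
  forall x, commutator_subgroup K x -> commutator_subgroup K (h x).
Proof.
move=> hM Kh; have [C1 CM CV] := commutator_subgroup_subgroup K.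
have h1 : h 1 = 1 by apply: (@mulgI _ (h 1)); rewrite -hM !mulg1.
have hV x : h x^-1 = (h x)^-1.
  by apply: (@mulgI _ (h x)); rewrite -hM !mulgV.
apply: (@smallest_sub _ is_subgroup _ [set x | commutator_subgroup K (h x)]).
  split=> /= [|x y|x]; first by rewrite h1.
  - by rewrite hM; apply: CM.
  - by rewrite hV; apply: CV.
move=> _ [a Ka [b Kb <-]] /=; apply: sub_gen_smallest.
exists (h a); first exact: Kh.
by exists (h b); [exact: Kh | rewrite /commg ?conjgE !hM !hV].
Qed.

Lemma commutator_subgroup_normal K :
  is_normal_subgroup K -> is_normal_subgroup (commutator_subgroup K).
Proof.
move=> [_ KJ]; split=> [|x g]; first exact: commutator_subgroup_subgroup.
by apply: (@commutator_subgroup_stable K (conjg^~ g)) => [a b|a];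
  [exact: conjMg | exact: KJ].
Qed.

End Subgroups.

Section QuotientGroup.
Variables (G : groupType) (K : set G) (nK : is_normal_subgroup K).

Definition coset_eq (x y : G) : bool := `[< K (x^-1 * y) >].

Let K1 : K 1. Proof. by case: nK => [[]]. Qed.
Let KM x y : K x -> K y -> K (x * y).
Proof. by case: nK => [[_ H _] _]; exact: H. Qed.
Let KV x : K x -> K x^-1. Proof. by case: nK => [[_ _ H] _]; exact: H. Qed.
Let KJ x g : K x -> K (x ^ g). Proof. by case: nK => [_ H]; exact: H. Qed.

Lemma coset_eq_equiv : equiv_class_of coset_eq.
Proof.
have sym x y : coset_eq x y -> coset_eq y x.
  by move=> /asboolP xy; apply/asboolP; move/KV: xy; rewrite invgM invgK.
split=> [x|x y|y x z].
- by apply/asboolP; rewrite mulVg.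
- by apply/idP/idP; exact: sym.
- move=> /asboolP xy /asboolP yz; apply/asboolP.
  by have := KM xy yz; rewrite -mulgA mulVKg.
Qed.

Canonical coset_eq_equiv_rel := EquivRelPack coset_eq_equiv.

Definition quotient_group : Type := {eq_quot coset_eq}.
HB.instance Definition _ := Choice.on quotient_group.
HB.instance Definition _ := Quotient.on quotient_group.
HB.instance Definition _ := EqQuotient.on quotient_group.

Definition quotient_class (x : G) : quotient_group := \pi_quotient_group x.

Lemma quotient_classP x y :
  quotient_class x = quotient_class y <-> K (x^-1 * y).
Proof.
split=> [/eqP|xy]; first by rewrite eqmodE => /asboolP.
by apply/eqP; rewrite eqmodE; apply/asboolP.
Qed.

Lemma quotient_class_repr (a : quotient_group) : quotient_class (repr a) = a.
Proof. exact: reprK. Qed.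

Definition quotient_mul (a b : quotient_group) : quotient_group :=
  quotient_class (repr a * repr b).
Definition quotient_inv (a : quotient_group) : quotient_group :=
  quotient_class (repr a)^-1.

Lemma quotient_mulE x y :
  quotient_mul (quotient_class x) (quotient_class y) = quotient_class (x * y).
Proof.
rewrite /quotient_mul; set x' := repr _; set y' := repr _.
have /quotient_classP xx : quotient_class x' = quotient_class x.
  exact: quotient_class_repr.
have /quotient_classP yy : quotient_class y' = quotient_class y.
  exact: quotient_class_repr.
apply/quotient_classP.
suff -> : (x' * y')^-1 * (x * y) = (x'^-1 * x) ^ y' * (y'^-1 * y).
  by apply: KM => //; apply: KJ.
by rewrite conjgE invgM !mulgA mulgK.
Qed.

Lemma quotient_invE x :
  quotient_inv (quotient_class x) = quotient_class x^-1.
Proof.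
rewrite /quotient_inv; set x' := repr _.
have /quotient_classP xx : quotient_class x' = quotient_class x.
  exact: quotient_class_repr.
apply/quotient_classP; rewrite invgK.
suff -> : x' * x^-1 = ((x'^-1 * x)^-1) ^ x'^-1 by apply/KJ/KV.
by rewrite conjgE invgM !invgK -!mulgA mulgV mulg1.
Qed.

Fact quotient_mulA : associative quotient_mul.
Proof.
move=> a b c; rewrite -(quotient_class_repr a) -(quotient_class_repr b).
by rewrite -(quotient_class_repr c) !quotient_mulE mulgA.
Qed.
Fact quotient_mul1 : left_id (quotient_class 1) quotient_mul.
Proof.
by move=> a; rewrite -(quotient_class_repr a) quotient_mulE mul1g.
Qed.
Fact quotient_mulx1 : right_id (quotient_class 1) quotient_mul.
Proof.
by move=> a; rewrite -(quotient_class_repr a) quotient_mulE mulg1.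
Qed.
Fact quotient_mulV :
  left_inverse (quotient_class 1) quotient_inv quotient_mul.
Proof.
move=> a; rewrite -(quotient_class_repr a) quotient_invE quotient_mulE.
by rewrite mulVg.
Qed.
Fact quotient_mulxV :
  right_inverse (quotient_class 1) quotient_inv quotient_mul.
Proof.
move=> a; rewrite -(quotient_class_repr a) quotient_invE quotient_mulE.
by rewrite mulgV.
Qed.

HB.instance Definition _ := isGroup.Build quotient_group
  quotient_mulA quotient_mul1 quotient_mulx1 quotient_mulV quotient_mulxV.

End QuotientGroup.

(* The letter (y, true) stands for y and (y, false) for its inverse.          *)
Section FreeGroup.
Variable Y : choiceType.
Implicit Types (a b : Y * bool) (w : seq (Y * bool)).

Definition letter_inv a : Y * bool := (a.1, ~~ a.2).

Definition reduced w : bool := sorted (fun a b => b != letter_inv a) w.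

Record free_group := FreeGroup {
  word : seq (Y * bool);
  word_reduced : reduced word
}.
HB.instance Definition _ := [isSub for word].
HB.instance Definition _ := [Choice of free_group by <:].

Definition push a w :=
  if w is b :: w' then if b == letter_inv a then w' else a :: w else [:: a].

Definition reduce w := foldr push [::] w.

Lemma letter_invK : involutive letter_inv.
Proof. by case=> y b; rewrite /letter_inv /= negbK. Qed.

Lemma push_reduced a w : reduced w -> reduced (push a w).
Proof.
case: w => [|b w] //= rw; case: eqP => [_|/eqP ab]; first exact: path_sorted rw.
by rewrite /reduced /= ab.
Qed.

Lemma foldr_push_reduced w w' : reduced w' -> reduced (foldr push w' w).
Proof. by move=> rw'; elim: w => //= a w; exact: push_reduced. Qed.

Lemma reduce_reduced w : reduced (reduce w).
Proof. exact: foldr_push_reduced. Qed.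

Lemma reduced_id w : reduced w -> reduce w = w.
Proof.
elim: w => // a w IH rw /=; rewrite -/(reduce w) (IH (path_sorted rw)).
by case: w rw {IH} => //= b w /andP[/negbTE ->].
Qed.

Lemma pushK a w : reduced w -> push (letter_inv a) (push a w) = w.
Proof.
case: w => [|b w] /=; first by rewrite letter_invK eqxx.
case: eqP => [-> |_] /=; last by rewrite letter_invK eqxx.
by case: w => [|c w] //= /andP[/negbTE ->].
Qed.

Lemma foldr_push_push a w w' : reduced w' ->
  foldr push w' (push a w) = push a (foldr push w' w).
Proof.
move=> rw'; case: w => [|b w] //=; case: eqP => [-> |//].
by rewrite -{1}(letter_invK a) pushK // foldr_push_reduced.
Qed.

Lemma foldr_push_reduce w w' : reduced w' ->
  foldr push w' (reduce w) = foldr push w' w.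
Proof. by move=> rw'; elim: w => //= a w <-; rewrite foldr_push_push. Qed.

Lemma reduce_cat w w' : reduce (w ++ w') = foldr push (reduce w') w.
Proof. by rewrite /reduce foldr_cat. Qed.

Lemma reduce_catl w w' : reduce (reduce w ++ w') = reduce (w ++ w').
Proof. by rewrite !reduce_cat foldr_push_reduce // reduce_reduced. Qed.

Lemma reduce_catr w w' : reduce (w ++ reduce w') = reduce (w ++ w').
Proof. by rewrite !reduce_cat (reduced_id (reduce_reduced _)). Qed.

Definition free_of_word w : free_group := FreeGroup (reduce_reduced w).
Definition free_one : free_group := free_of_word [::].
Definition free_mul (u v : free_group) : free_group :=
  free_of_word (word u ++ word v).
Definition free_inv (u : free_group) : free_group :=
  free_of_word (rev (map letter_inv (word u))).

Lemma reduce_revK w : reduce (rev (map letter_inv w) ++ w) = [::].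
Proof.
elim: w => //= a w IH; rewrite rev_cons cat_rcons reduce_cat /=.
rewrite -/(reduce w) pushK; last exact: reduce_reduced.
by rewrite -reduce_cat.
Qed.

Lemma reduce_Krev w : reduce (w ++ rev (map letter_inv w)) = [::].
Proof.
set w' := rev _; have -> : w = rev (map letter_inv w').
  by rewrite /w' map_rev revK -map_comp (eq_map letter_invK) map_id.
exact: reduce_revK.
Qed.

Fact free_mulA : associative free_mul.
Proof.
by move=> u v w; apply/val_inj; rewrite /= reduce_catl reduce_catr catA.
Qed.
Fact free_mul1 : left_id free_one free_mul.
Proof. by move=> u; apply/val_inj; rewrite /= reduced_id ?word_reduced. Qed.
Fact free_mulx1 : right_id free_one free_mul.
Proof.
by move=> u; apply/val_inj; rewrite /= cats0 reduced_id ?word_reduced.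
Qed.
Fact free_mulV : left_inverse free_one free_inv free_mul.
Proof. by move=> u; apply/val_inj; rewrite /= reduce_catl reduce_revK. Qed.
Fact free_mulxV : right_inverse free_one free_inv free_mul.
Proof. by move=> u; apply/val_inj; rewrite /= reduce_catr reduce_Krev. Qed.

HB.instance Definition _ := isGroup.Build free_group
  free_mulA free_mul1 free_mulx1 free_mulV free_mulxV.

Definition free_gen (y : Y) : free_group := free_of_word [:: (y, true)].

(* The product of the g u_i ^ epsilon_i for the word prod u_i ^ epsilon_i.    *)
Definition word_prod (G : groupType) (g : Y -> G) w : G :=
  \prod_(a <- w) (if a.2 then g a.1 else (g a.1)^-1).

Section WordProd.
Variables (G : groupType) (g : Y -> G).

Lemma word_prod_push a w : word_prod g (push a w) = word_prod g (a :: w).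
Proof.
case: w => [|b w] //=; case: eqP => [-> |//]; rewrite /word_prod !big_cons /=.
by case: a => y [] /=; rewrite ?mulKg ?mulVKg.
Qed.

Lemma word_prod_reduce w : word_prod g (reduce w) = word_prod g w.
Proof.
elim: w => //= a w IH; rewrite word_prod_push.
by rewrite /word_prod !big_cons -!/(word_prod _ _) IH.
Qed.

Lemma word_prodM (u v : free_group) :
  word_prod g (word (u * v)) = word_prod g (word u) * word_prod g (word v).
Proof. by rewrite [word _]/= word_prod_reduce /word_prod big_cat. Qed.

Lemma word_prod_gen y : word_prod g (word (free_gen y)) = g y.
Proof. by rewrite /word_prod big_seq1. Qed.

End WordProd.

Lemma word_prod_free_gen w : word_prod free_gen w = free_of_word w.
Proof.
elim: w => [|[y b] w IH]; first by rewrite /word_prod big_nil; apply/val_inj.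
rewrite /word_prod big_cons -/(word_prod _ _) IH.
have -> : (if (y, b).2 then free_gen (y, b).1 else (free_gen (y, b).1)^-1)
    = free_of_word [:: (y, b)] by case: b; apply/val_inj.
by apply/val_inj; exact: (reduce_catr [:: (y, b)] w).
Qed.

Lemma word_prod_id (u : free_group) : word_prod free_gen (word u) = u.
Proof.
by rewrite word_prod_free_gen; apply/val_inj; exact/reduced_id/word_reduced.
Qed.

Lemma word_prod_congr (G : groupType) (K : set G) (g h : Y -> G) w :
  is_normal_subgroup K -> (forall y, K ((g y)^-1 * h y)) ->
  K ((word_prod g w)^-1 * word_prod h w).
Proof.
move=> [[K1 KM KV] KJ] Kgh.
have KMM (a a' b b' : G) : K (a^-1 * a') -> K (b^-1 * b') ->
    K ((a * b)^-1 * (a' * b')).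
  move=> Ka Kb; suff -> : (a * b)^-1 * (a' * b') = (a^-1 * a') ^ b * (b^-1 * b').
    by apply: KM => //; apply: KJ.
  by rewrite conjgE invgM !mulgA mulgK.
elim: w => [|[y b] w IH]; first by rewrite /word_prod !big_nil mulVg.
rewrite /word_prod !big_cons -!/(word_prod _ _); apply: KMM => //.
case: b => //=; rewrite invgK.
suff -> : g y * (h y)^-1 = ((g y)^-1 * h y)^-1 ^ (g y)^-1 by apply/KJ/KV.
by rewrite conjgE invgM !invgK -!mulgA mulgV mulg1.
Qed.

End FreeGroup.

(* Commutative words in X are finite multisets; excluding the empty one gives *)
(* the free commutative semigroup without identity.                           *)
Definition free_com_semigroup (X : Type) : Type :=
  {A : {mset {classic X}}%mset | A != mset0}.
HB.instance Definition _ X := Choice.on (free_com_semigroup X).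

Fact mset_sum_neq0 (T : choiceType) (A B : {mset T}%mset) :
  A != mset0 -> (A `+` B)%mset != mset0.
Proof.
apply: contra => /eqP AB; apply/eqP/msetP => a.
by have /eqP := congr1 (fun C : {mset T}%mset => C a) AB;
  rewrite msetE2 mset0E addn_eq0 => /andP[/eqP].
Qed.

Definition com_semigroup_circ X (l m : free_com_semigroup X) :
  free_com_semigroup X := exist _ (val l `+` val m)%mset
    (mset_sum_neq0 (val m) (valP l)).
HB.instance Definition _ X :=
  hasCirc.Build (free_com_semigroup X) (@com_semigroup_circ X).

Fact mset1_neq0 (T : choiceType) (x : T) : [mset x]%mset != mset0.
Proof.
apply/eqP => /(congr1 (fun C : {mset T}%mset => C x)).
by rewrite msetnE mset0E eqxx.
Qed.

Definition com_semigroup_gen X (x : X) : free_com_semigroup X :=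
  exist _ [mset (x : {classic X})]%mset (mset1_neq0 (x : {classic X})).

Section FreeComWire.
Variable X : Type.
Local Notation Y := (free_com_semigroup X).
Local Notation F := (free_group Y).
Implicit Types (l m : Y) (u v : F).

(* u ∘ l for l in Y, i.e. (prod_i ((u_i ∘ l) ⋆ l^-1)^epsilon_i) ⋆ l.          *)
Definition circ_letter u l : F :=
  word_prod (fun m => free_gen (m \circ l) * (free_gen l)^-1) (word u)
  * free_gen l.

(* u ∘_l v, i.e. u ⋆ prod_j (u^-1 ⋆ (u ∘ v_j))^delta_j.                       *)
Definition circ_left u v : F :=
  u * word_prod (fun m => u^-1 * circ_letter u m) (word v).

(* Both operations may be computed on arbitrary words.                        *)
Lemma circ_letter_word w l :
  circ_letter (word_prod (@free_gen Y) w) l =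
  word_prod (fun m => free_gen (m \circ l) * (free_gen l)^-1) w * free_gen l.
Proof. by rewrite /circ_letter word_prod_free_gen word_prod_reduce. Qed.

Lemma circ_left_word u w :
  circ_left u (word_prod (@free_gen Y) w) =
  u * word_prod (fun m => u^-1 * circ_letter u m) w.
Proof. by rewrite /circ_left word_prod_free_gen word_prod_reduce. Qed.

(* The normal subgroup N = P_c(X)^2 and N' = [N, N].                          *)
Definition wire_kernel : set F :=
  normal_closure [set x | exists m l : Y,
    x = (free_gen m)^-1 * free_gen (m \circ l) * (free_gen l)^-1].

Definition wire_kernel' : set F := commutator_subgroup wire_kernel.

Lemma wire_kernel'_normal : is_normal_subgroup wire_kernel'.
Proof. exact/commutator_subgroup_normal/normal_closure_normal. Qed.

Definition free_com_wire : Type := quotient_group wire_kernel'_normal.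
HB.instance Definition _ := Group.on free_com_wire.

Definition wire_class u : free_com_wire :=
  quotient_class wire_kernel'_normal u.

Definition wire_gen (x : X) : free_com_wire :=
  wire_class (free_gen (com_semigroup_gen x)).

(* The choice of representatives is immaterial by wire_class_circ below.      *)
Definition wire_circ (a b : free_com_wire) : free_com_wire :=
  wire_class (circ_left (repr a) (repr b)).
HB.instance Definition _ := hasCirc.Build free_com_wire wire_circ.


Let kernel_normal : is_normal_subgroup wire_kernel.
Proof. exact: normal_closure_normal. Qed.

(* An endomorphism of F inducing the identity on F / N preserves N'.          *)
Let kernel'_stable (h : Y -> F) x :
  (forall y, wire_kernel ((free_gen y)^-1 * h y)) -> wire_kernel' x ->
  wire_kernel' (word_prod h (word x)).
Proof.
move=> Kh; apply: (@commutator_subgroup_stable _ _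
    (fun u => word_prod h (word u))).
  by move=> u v; rewrite word_prodM.
move=> u Ku; have := word_prod_congr (word u) kernel_normal Kh.
rewrite word_prod_id; case: kernel_normal => [[_ KM _] _] /(KM _ _ Ku).
by rewrite mulVKg.
Qed.

Let kernel_letter l m : wire_kernel
  ((free_gen m)^-1 * (free_gen (m \circ l) * (free_gen l)^-1)).
Proof. by rewrite mulgA; apply: sub_gen_smallest; exists m, l. Qed.

Let kernel_step u m : wire_kernel ((free_gen m)^-1 * (u^-1 * circ_letter u m)).
Proof.
rewrite /circ_letter (mulgA u^-1).
have := word_prod_congr (word u) kernel_normal (kernel_letter m).
by rewrite word_prod_id; case: kernel_normal => [_]; apply.
Qed.

Lemma circ_left_congr u u' v v' : wire_class u = wire_class u' ->
  wire_class v = wire_class v' ->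
  wire_class (circ_left u v) = wire_class (circ_left u' v').
Proof.
move=> uu' /quotient_classP Kv; have /quotient_classP Ku := uu'.
have [[K1 KM KV] KJ] := wire_kernel'_normal.
transitivity (wire_class (circ_left u v')).
  apply/quotient_classP.
  rewrite /circ_left invgM -mulgA mulKg.
  have := kernel'_stable (kernel_step u) Kv.
  set h := (fun m => u^-1 * circ_letter u m); rewrite word_prodM.
  suff -> : word_prod h (word v^-1) = (word_prod h (word v))^-1 by [].
  apply: (@mulgI _ (word_prod h (word v))).
  by rewrite -word_prodM !mulgV /word_prod big_nil.
have mulE a b : wire_class (a * b) = wire_class a * wire_class b.
  by symmetry; exact: quotient_mulE.
rewrite /circ_left !mulE uu'; congr (_ * _); apply/quotient_classP.
apply: word_prod_congr (wire_kernel'_normal) _ => m.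
apply/(quotient_classP wire_kernel'_normal).
have invE a : wire_class a^-1 = (wire_class a)^-1.
  by symmetry; exact: quotient_invE.
change (wire_class (u^-1 * circ_letter u m)
  = wire_class (u'^-1 * circ_letter u' m)).
rewrite !mulE !invE uu'; congr (_ * _).
congr (_ * _).
apply/(quotient_classP wire_kernel'_normal).
have := kernel'_stable (kernel_letter m) Ku; rewrite word_prodM.
set h := (fun y => _).
suff -> : word_prod h (word u^-1) = (word_prod h (word u))^-1 by [].
apply: (@mulgI _ (word_prod h (word u))).
by rewrite -word_prodM !mulgV /word_prod big_nil.
Qed.

Lemma wire_class_circ u v :
  wire_class u \circ wire_class v = wire_class (circ_left u v).
Proof. by apply: circ_left_congr; exact: quotient_class_repr. Qed.

End FreeComWire.

(* Main.v *)
(* F/N' embeds jointly into the groups of pairs (i, p), i in Z and p in K[t]   *)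
(* with K = Frac Z[z], under                                                  *)
(*   (i, p) * (j, q) = (i + j, p + z^i (q - 1)),                              *)
(*   (i, p) o (j, q) = (i + j, p q).                                          *)
(* A commutative word m of weight k goes to (k, t^k), where the weight runs   *)
(* through additive maps from multisets to nat; this is the Magnus embedding  *)
(* by Fox derivatives, and p = 1 + sum_e n_e z^(weight of a) (t^(weight of y) *)
(* - 1), where n_e counts with sign the passages of the path of u through the *)
(* edge e = (a, y) of the Cayley graph of F/N. If all images of u are trivial *)
(* then every n_e vanishes, because weights separate any finite set of        *)
(* multisets; and u, a product of Schreier generators which commute modulo    *)
(* N', is then trivial modulo N'. Hence F/N' is a commutative wire; and it is *)
(* cancellative, because all the p take the value 1 at t = 1.                 *)
(* A brace kills N' because in any commutative wire the elements              *)
(* a^-1 (a o b) b^-1 commute with each other and with their conjugates.       *)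
(* Finally a o preserves the ternary operation b c^-1 d, which makes the      *)
(* fractions over a common denominator satisfy the brace axioms.              *)
From HB Require Import structures.
From mathcomp Require Import all_boot all_algebra.
From mathcomp Require Import finmap multiset.
From mathcomp Require Import boolp classical_sets.
Require Import Defs.

Set Implicit Arguments.
Unset Strict Implicit.
Unset Printing Implicit Defensive.

Local Open Scope classical_set_scope.
Local Open Scope quotient_scope.
Local Open Scope group_scope.

(** * Commutative wires *)

(** Three facts about F/N' carry the theorem: it is a commutative wire ([free_com_wire_wire]), ∘ is
    cancellative in it ([free_com_wire_circI]), and a semigroup map from Y to any commutative wire
    extends to it ([wire_liftM], [wire_lift_circ]). The first two are visible for Magnus pairs and
    are pulled back along the maps [magnus_lift], which are jointly injective by
    [magnus_rep_faithful]. The third holds because the image of N is commutative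
    ([wire_star_commute], [wire_stars_normal_commute]), so N' is killed. The rest is localization of
    the commutative semigroup (F/N', ∘) at all its elements. Cancellation makes cross-multiplication
    transitive, [com_wire_heap] lets ⋆ descend to fractions, and a wire morphism into a brace
    extends uniquely because the images of denominators are ∘-invertible there
    ([frac_lift_morphism], [frac_lift_unique]). *)

Section GroupTheory.
Variable G : groupType.
Implicit Types (A : set G) (x y z : G).

Definition gsimpl :=
  (@invgM G, @invgK G, @invg1 G, @mulgA G, @mulgK G, @mulgVK G, @mulVg G,
   @mulgV G, @mul1g G, @mulg1 G).

Definition commutant A : set G := [set x | forall y, A y -> commute x y].

Lemma commutant_subgroup A : is_subgroup (commutant A).
Proof.
split=> [y _|x y Cx Cy z Az|x Cx z Az]; apply/commute_sym.
- exact: commute1.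
- by apply: commuteM; apply/commute_sym; [apply: Cx | apply: Cy].
- exact/commuteV/commute_sym/Cx.
Qed.

Lemma commutant_normal A : (forall x g, A x -> A (x ^ g)) ->
  is_normal_subgroup (commutant A).
Proof.
move=> AJ; split=> [|x g Cx y Ay]; first exact: commutant_subgroup.
have E : commute x (y ^ g^-1) by apply/Cx/AJ.
by rewrite /commute -[y](conjgKV g) -!conjMg E.
Qed.

End GroupTheory.

Section GroupMorphism.
Variables (G H : groupType) (h : G -> H).
Hypothesis hM : {morph h : x y / x * y}.

Lemma morph_one : h 1 = 1.
Proof. by apply: (@mulgI _ (h 1)); rewrite -hM !mulg1. Qed.

Lemma morph_inv x : h x^-1 = (h x)^-1.
Proof. by apply: (@mulgI _ (h x)); rewrite -hM !mulgV morph_one. Qed.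

Lemma morph_word_prod (Y : choiceType) (g : Y -> G) w :
  h (word_prod g w) = word_prod (h \o g) w.
Proof.
rewrite /word_prod (big_morph h hM morph_one).
by apply: eq_bigr => -[y []] //= _; rewrite morph_inv.
Qed.

Lemma preimage_normal (A : set H) : is_normal_subgroup A ->
  is_normal_subgroup (h @^-1` A).
Proof.
move=> [[A1 AM AV] AJ]; split; first split => /=.
- by rewrite morph_one.
- by move=> x y Ax Ay; rewrite hM; apply: AM.
- by move=> x Ax; rewrite morph_inv; apply: AV.
- by move=> x g Ax /=; rewrite conjgE !hM morph_inv -conjgE; apply: AJ.
Qed.

End GroupMorphism.

Lemma eq_word_prod (Y : choiceType) (G : groupType) (g g' : Y -> G) w :
  g =1 g' -> word_prod g w = word_prod g' w.
Proof. by move=> gg'; apply: eq_bigr => -[y []] //= _; rewrite gg'. Qed.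

Record com_wire (W : groupType) (op : W -> W -> W) : Prop := ComWire {
  com_wireA : associative op;
  com_wireC : commutative op;
  com_wireD : forall a b c, op a (b * c) = op a b * a^-1 * op a c
}.

Section ComWireTheory.
Variables (W : groupType) (op : W -> W -> W).
Hypothesis wireW : com_wire op.
Local Notation "x ∘ y" := (op x y) (at level 40, left associativity).
Implicit Types a b c d : W.

Let opA := com_wireA wireW.
Let opC := com_wireC wireW.
Let opD := com_wireD wireW.

Lemma com_wireAC a b c : a ∘ b ∘ c = a ∘ c ∘ b.
Proof. by rewrite -!opA (opC b). Qed.

Lemma com_wireCA a b c : a ∘ (b ∘ c) = b ∘ (a ∘ c).
Proof. by rewrite !opA (opC a). Qed.

Lemma com_wireACA a b c d : a ∘ b ∘ (c ∘ d) = a ∘ c ∘ (b ∘ d).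
Proof. by rewrite !opA (com_wireAC a b). Qed.

Lemma com_wirex1 a : a ∘ 1 = a.
Proof.
have /eqP := opD a 1 1; rewrite mulg1 -{1}[a ∘ 1]mul1g (inj_eq (@mulIg _ _)).
by rewrite eq_sym divg_eq mul1g => /eqP.
Qed.

Lemma com_wire1x a : 1 ∘ a = a.
Proof. by rewrite opC com_wirex1. Qed.

Lemma com_wireV a b : a ∘ b^-1 = a * (a ∘ b)^-1 * a.
Proof.
apply: (@mulgI _ (a ∘ b * a^-1)); rewrite -opD mulgV com_wirex1.
by rewrite !gsimpl.
Qed.

Lemma com_wire_heap a b c d :
  a ∘ (b * c^-1 * d) = (a ∘ b) * (a ∘ c)^-1 * (a ∘ d).
Proof. by rewrite !opD com_wireV !gsimpl. Qed.

Lemma com_wire_heapl a b c d :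
  (b * c^-1 * d) ∘ a = (b ∘ a) * (c ∘ a)^-1 * (d ∘ a).
Proof. by rewrite !(opC _ a) com_wire_heap. Qed.

Lemma com_wireDl a b c : (b * c) ∘ a = (b ∘ a) * a^-1 * (c ∘ a).
Proof. by rewrite opC opD !(opC a). Qed.

Definition wire_star a b := a^-1 * (a ∘ b) * b^-1.

(* Expand (a b) ∘ (c d) by distributing first on the left, then on the right. *)
Lemma wire_star_commute a b c d : commute (wire_star a d) (wire_star c b).
Proof.
have := com_wireDl (c * d) a b; rewrite opD !com_wireDl !opD !gsimpl.
rewrite -!mulgA => /mulgI; rewrite !mulgA => /mulIg E.
by rewrite /commute /wire_star (opC c b) !gsimpl E.
Qed.

Definition wire_stars : set W := [set x | exists a b, x = wire_star a b].

Lemma wire_star_conj a b c :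
  wire_star a c ^ b = wire_star (a * b) c * (wire_star b c)^-1.
Proof. by rewrite /wire_star conjgE com_wireDl !gsimpl. Qed.

Lemma commutant_wire_stars_normal : is_normal_subgroup (commutant wire_stars).
Proof.
have CS := commutant_subgroup wire_stars; split=> // x g Cx _ [a [b ->]].
have E : commute x (wire_star a b ^ g^-1).
  rewrite wire_star_conj; apply: commuteM; first by apply: Cx; do 2!eexists.
  by apply/commuteV/Cx; do 2!eexists.
by rewrite /commute -[wire_star a b](conjgKV g) -!conjMg E.
Qed.

(* By wire_star_conj, commuting with all stars is a condition stable under    *)
(* conjugation, so it passes from the stars to their normal closure.          *)
Lemma wire_stars_normal_commute (A : set W) :
  A `<=` normal_closure wire_stars ->
  forall x y, A x -> A y -> commute x y.
Proof.
move=> sub x y Ax Ay; have CN := commutant_wire_stars_normal.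
have [_ CJ] := CN.
have Cy : commutant wire_stars y.
  apply: (sub _ Ay) => //; split=> // _ [a [b ->]] _ [c [d ->]].
  exact: wire_star_commute.
(* The double commutant is a normal subgroup containing the stars, hence contains [x], while [y]
   lies in the commutant. *)
apply: (sub _ Ax (commutant (commutant wire_stars)) _) => //.
split; first exact: commutant_normal.
by move=> s Ss z Cz; apply/commute_sym/Cz.
Qed.
End ComWireTheory.

(** * Weights and Magnus pairs *)

Section Weights.
Variable K : choiceType.
Local Open Scope nat_scope.
Implicit Types (A : {mset K}%mset) (s : seq K).

(* Reads the multiplicities of A along s as digits in base b. *)
Definition mset_weight (b : nat) s A : nat :=
  foldr (fun x n => A x + n * b) 0 s.

Lemma mset_weight0 b s : mset_weight b s mset0 = 0.
Proof. by elim: s => //= x s ->; rewrite mset0E. Qed.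

Lemma mset_weightD b s A A' :
  mset_weight b s (A `+` A')%mset = mset_weight b s A + mset_weight b s A'.
Proof. by elim: s => //= x s ->; rewrite msetE2 mulnDl addnACA. Qed.

Lemma mset_weight_digits b s A A' :
  (forall x, A x < b) -> (forall x, A' x < b) ->
  mset_weight b s A = mset_weight b s A' -> {in s, A =1 A'}.
Proof.
move=> Ab A'b; have b_gt0 (x : K) : 0 < b by apply: leq_ltn_trans (Ab x).
elim: s => //= x s IH E y; rewrite inE.
have Ex : A x = A' x.
  have := congr1 (modn^~ b) E; rewrite ![_ + _ * b]addnC !modnMDl.
  by rewrite !modn_small.
case/predU1P=> [-> //|ys]; apply: IH => //.
by move: E; rewrite Ex => /addnI/eqP; rewrite eqn_pmul2r ?(b_gt0 x) // => /eqP.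
Qed.

Lemma mset_weight_separates (ms : seq {mset K}%mset) :
  exists b s, {in ms &, injective (mset_weight b s)}.
Proof.
(* The base exceeds every multiplicity occurring in [ms], and [s] covers all supports; outside them
   all multiplicities are 0. *)
exists (\sum_(A <- ms) size (enum_mset A)).+1.
exists (flatten [seq enum_mset A | A <- ms]) => A A' msA msA' E.
have lt_size B x : B \in ms -> B x < (\sum_(A <- ms) size (enum_mset A)).+1.
  move=> msB; rewrite ltnS -count_mem_mset; apply: leq_trans (count_size _ _) _.
  by rewrite (big_rem B) //= leq_addr.
have EAA' := mset_weight_digits (fun x => lt_size A x msA)
  (fun x => lt_size A' x msA') E.
have digit x B : B \in ms -> B x > 0 -> A x = A' x.
  move=> msB Bx; apply/EAA'/flattenP; exists (enum_mset B); first exact: map_f.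
  by rewrite -mset_gt0.
apply/msetP => x; have [Ax|/digit->//] := posnP (A x).
by have [A'x|/digit->//] := posnP (A' x); rewrite Ax A'x.
Qed.

End Weights.

Section Magnus.
Import GRing.Theory Num.Theory.
Local Open Scope ring_scope.

(** A field gives z negative powers and makes the polynomials over it a domain, as cancellation
    requires. *)
Definition laurent_field : Type := {fraction {poly int}}.
HB.instance Definition _ := GRing.Field.on laurent_field.

Definition laurent_var : laurent_field := tofrac 'X.
Local Notation z := laurent_var.

Lemma laurent_var_neq0 : z != 0.
Proof. by rewrite tofrac_eq0 polyX_eq0. Qed.

Lemma laurent_var_expzD i j : z ^ (i + j) = z ^ i * z ^ j.
Proof. exact/expfzDr/laurent_var_neq0. Qed.

(* The pair (i, p) stands for the affine map q |-> z^i q + (p - 1). *)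
Definition magnus : Type := (int * {poly laurent_field})%type.
HB.instance Definition _ := Choice.on magnus.
Implicit Types a b c : magnus.

Definition magnus_mul a b : magnus := (a.1 + b.1, a.2 + z ^ a.1 *: (b.2 - 1)).
Definition magnus_inv a : magnus := (- a.1, 1 - z ^ (- a.1) *: (a.2 - 1)).
Definition magnus_circ a b : magnus := (a.1 + b.1, a.2 * b.2).

Fact magnus_mulA : associative magnus_mul.
Proof.
move=> a b c; congr pair => /=; first exact: addrA.
by rewrite laurent_var_expzD -scalerA [_ + _ - 1 in LHS]addrAC scalerDr addrA.
Qed.
Fact magnus_mul1 : left_id (0, 1) magnus_mul.
Proof. by case=> i p; rewrite /magnus_mul /= add0r scale1r subrKC. Qed.
Fact magnus_mulx1 : right_id (0, 1) magnus_mul.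
Proof. by case=> i p; rewrite /magnus_mul /= addr0 subrr scaler0 addr0. Qed.
Fact magnus_mulV : left_inverse (0, 1) magnus_inv magnus_mul.
Proof. by case=> i p; rewrite /magnus_mul /= addNr subrK. Qed.
Fact magnus_mulxV : right_inverse (0, 1) magnus_inv magnus_mul.
Proof.
case=> i p; rewrite /magnus_mul /= subrr addrAC subrr add0r scalerN scalerA.
by rewrite -laurent_var_expzD subrr scale1r opprB subrKC.
Qed.

HB.instance Definition _ := isGroup.Build magnus
  magnus_mulA magnus_mul1 magnus_mulx1 magnus_mulV magnus_mulxV.

(** For distributivity, multiplying a ∘ b by a^-1 brings the shift back to that of b = (j, q); with
    a = (i, p) and c = (k, r), both sides have second component p q + z^j (p r - p). *)
Lemma magnus_wire : com_wire magnus_circ.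
Proof.
split=> [a b c|a b|a b c]; first by congr pair; rewrite ?addrA ?mulrA.
  by congr pair; [exact: addrC | exact: mulrC].
have E : (a.1 + b.1 - a.1)%R = b.1 by rewrite addrC addKr.
congr pair => /=; first by rewrite E addrCA.
rewrite E [1 - _]addrC addrK scalerN scalerA -laurent_var_expzD E.
rewrite -addrA [- _ + _]addrC -scalerBr mulrDr -scalerAr; congr (_ + _ *: _).
by rewrite opprB addrA subrK mulrBr mulr1.
Qed.

Lemma magnus_circI a b c :
  c.2 != 0 -> magnus_circ a c = magnus_circ b c -> a = b.
Proof.
case: a b => [i p] [j q] /= c0 [/addIr -> E]; congr pair.
exact: mulIf c0 _ _ E.
Qed.

Lemma magnus_augmentation_subgroup :
  is_subgroup [set a : magnus | (a.2).[1] = 1].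
Proof.
split=> [|a b /= a1 b1|a /= a1] /=; first by rewrite hornerC.
  by rewrite hornerE hornerZ hornerE a1 b1 hornerE hornerE subrr mulr0 addr0.
by rewrite !hornerE a1 subrr mulr0 oppr0 addr0.
Qed.

End Magnus.

(** * Linear independence of the powers of z over the integers *)

Section LaurentIndependence.
Import GRing.Theory Num.Theory.
Local Open Scope ring_scope.

Lemma common_shift (ks : seq int) :
  exists m : nat, forall k, k \in ks -> k + m%:Z = absz (k + m%:Z).
Proof.
elim: ks => [|k ks [m Hm]]; first by exists 0%N.
exists (m + absz k)%N => k1; rewrite inE => ks1; rewrite gez0_abs // PoszD addrA.
case/predU1P: ks1 => [->|/Hm ->]; last by rewrite -PoszD.
rewrite addrAC abszE; apply: addr_ge0 => //.
by rewrite -lerBlDl sub0r -normrN ler_norm.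
Qed.

(** Multiplication by a high power of z clears negative exponents; coefficients are then compared in
    Z[z], which embeds in its fraction field. *)
Lemma laurent_var_indep (I : Type) (s : seq I) (c k : I -> int) :
  \sum_(i <- s) (c i)%:~R * laurent_var ^ k i = 0 ->
  forall k0, \sum_(i <- s | k i == k0) c i = 0.
Proof.
move=> E k0; have [m Hm] := common_shift (k0 :: map k s).
(* Since [k0] is shifted along with the [k i], [e] identifies none of the exponents compared
   below. *)
pose e (j : int) := absz (j + m%:Z).
have : \sum_(i <- s) (c i) *: 'X^(e (k i)) = 0 :> {poly int}.
  apply/eqP; rewrite -tofrac_eq0 rmorph_sum /=; apply/eqP.
  have := congr1 (fun x => x * laurent_var ^ m%:Z) E.
  rewrite mul0r mulr_suml => E'; rewrite -[RHS]E'.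
  elim: s {E E'} Hm => [|i s IH] Hm; first by rewrite !big_nil.
  rewrite !big_cons IH => [|j]; last first.
    by rewrite inE => /predU1P[->|js]; apply: Hm; rewrite !inE ?eqxx // js !orbT.
  congr (_ + _); rewrite -mulrA -laurent_var_expzD Hm ?inE ?eqxx ?orbT //.
  by rewrite -mul_polyC rmorphM /= rmorphXn /= -[c i in LHS]intz !rmorph_int.
move/(congr1 (fun p : {poly int} => p`_(e k0))); rewrite coef0 coef_sum.
move=> C; rewrite -[RHS]C.
elim: s Hm {E C} => [|i s IH] Hm; first by rewrite !big_nil.
rewrite !big_cons IH => [|j]; last first.
  by rewrite inE => /predU1P[->|js]; apply: Hm; rewrite !inE ?eqxx // js !orbT.
rewrite coefZ coefXn; have -> : (e k0 == e (k i)) = (k i == k0).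
  rewrite -eqz_nat -!Hm ?inE ?eqxx ?orbT // eq_sym; exact: (inj_eq (addIr _)).
by case: eqP; rewrite ?mulr1 // mulr0 add0r.
Qed.

End LaurentIndependence.

(** * Signed words in commuting letters *)

Section BalancedWords.
Variable Z : choiceType.
Implicit Types w : seq (Z * bool).

Definition balanced w : Prop :=
  forall z, count_mem (z, true) w = count_mem (z, false) w.

Lemma balanced_cons_cancel z b w1 w2 :
  balanced ((z, b) :: w1 ++ (z, ~~ b) :: w2) -> balanced (w1 ++ w2).
Proof.
move=> /[swap] z' /(_ z'); rewrite /= !count_cat /= !xpair_eqE.
by case: (z == z') b => -[] /=; rewrite ?add0n ?add1n ?addnS // => -[].
Qed.

(** The opposite of the first letter occurs further on; commuting past what lies between, the two
    cancel, and induction on length applies. *)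
Lemma word_prod_balanced (G : groupType) (t : Z -> G) w :
  (forall z z', commute (t z) (t z')) -> balanced w -> word_prod t w = 1.
Proof.
move=> tC; have [n] := ubnP (size w); elim: n w => // n IH [|[z b] w] /=.
  by rewrite /word_prod big_nil.
rewrite ltnS => wn Bw.
have : (z, ~~ b) \in w.
  rewrite -has_pred1 has_count.
  by move: (Bw z); case: b {Bw} => /=; rewrite !xpair_eqE eqxx /= add1n add0n;
    [move<- | move->].
move=> zw; case/splitPr: zw wn Bw => w1 w2 wn Bw.
have tw1 : commute (t z) (word_prod t w1).
  by apply: commute_prod => -[y []] //= _; apply: commuteV.
have := IH (w1 ++ w2) _ (balanced_cons_cancel Bw).
rewrite /word_prod !(big_cons, big_cat) /= -!/(word_prod _ _) => E.
rewrite -[RHS]E; last by move: wn; rewrite !size_cat /= addnS; exact: ltnW.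
case: b {Bw wn} => /=.
  by rewrite mulgA tw1 -mulgA mulVKg.
by rewrite [X in _ * X]mulgA -tw1 -mulgA mulKg.
Qed.

End BalancedWords.

(** * The wire F/N' *)

Section FreeComWireTheory.
Variable X : Type.
Local Notation Y := (free_com_semigroup X).
Local Notation F := (free_group Y).
Implicit Types (l m : Y) (u v : F).

Lemma wire_classM u v : wire_class (u * v) = wire_class u * wire_class v.
Proof. by symmetry; exact: quotient_mulE. Qed.

Lemma wire_classV u : wire_class u^-1 = (wire_class u)^-1.
Proof. exact: (morph_inv wire_classM). Qed.

Lemma wire_class1 : wire_class 1 = 1 :> free_com_wire X.
Proof. exact: (morph_one wire_classM). Qed.

Lemma wire_class_repr (a : free_com_wire X) : wire_class (repr a) = a.
Proof. exact: quotient_class_repr. Qed.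

Lemma wire_class_eq1 u : wire_class u = 1 <-> wire_kernel' u.
Proof.
rewrite -wire_class1; split; last first.
  move=> Ku; apply/quotient_classP; rewrite mulg1.
  by have [[_ _ KV] _] := wire_kernel'_normal X; apply: KV.
by move/esym/quotient_classP; rewrite invg1 mul1g.
Qed.

(** * Extension of semigroup maps on Y to F/N' *)

Section Lift.
Variables (W : groupType) (op : W -> W -> W) (g : Y -> W).
Hypotheses (wireW : com_wire op).
Hypothesis gM : forall l m, g (l \circ m) = op (g l) (g m).

Definition word_lift u : W := word_prod g (word u).

Lemma word_liftM : {morph word_lift : u v / u * v}.
Proof. exact: word_prodM. Qed.

(** In a commutative wire b -> (b ∘ c) ⋆ c^-1 is a group endomorphism; the formula for u ∘ l
    prescribes its values on generators. The next lemma uses b -> c^-1 ⋆ (c ∘ b) likewise. *)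
Lemma word_lift_circ_letter u l :
  word_lift (circ_letter u l) = op (word_lift u) (g l).
Proof.
pose r b := op b (g l) * (g l)^-1.
have rM : {morph r : b c / b * c}.
  by move=> b c; rewrite /r (com_wireDl wireW) !gsimpl.
rewrite /circ_letter word_liftM (morph_word_prod word_liftM).
rewrite [word_lift (free_gen l)]word_prod_gen (@eq_word_prod _ _ _ (r \o g)).
  by rewrite -(morph_word_prod rM) /r !gsimpl.
move=> m /=; rewrite word_liftM (morph_inv word_liftM).
by rewrite /word_lift !word_prod_gen gM.
Qed.

Lemma word_lift_circ_left u v :
  word_lift (circ_left u v) = op (word_lift u) (word_lift v).
Proof.
pose r b := (word_lift u)^-1 * op (word_lift u) b.
have rM : {morph r : b c / b * c}.
  by move=> b c; rewrite /r (com_wireD wireW) !gsimpl.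
rewrite /circ_left word_liftM (morph_word_prod word_liftM).
rewrite (@eq_word_prod _ _ _ (r \o g)).
  by rewrite -(morph_word_prod rM) /r !gsimpl.
move=> m /=; rewrite word_liftM (morph_inv word_liftM).
by rewrite word_lift_circ_letter.
Qed.

Lemma word_lift_kernel u : wire_kernel u ->
  normal_closure (wire_stars op) (word_lift u).
Proof.
move: u; apply: smallest_sub (word_lift @^-1` normal_closure (wire_stars op)) _ _.
  apply: (preimage_normal word_liftM); exact: normal_closure_normal.
move=> _ [m [l ->]] /=; apply: sub_gen_smallest; exists (g m), (g l).
rewrite !word_liftM !(morph_inv word_liftM) /word_lift !word_prod_gen gM.
by [].
Qed.

(** N is mapped into the normal closure of the stars, whose elements commute, so commutators of N
    vanish. *)
Lemma word_lift_kernel' u : wire_kernel' u -> word_lift u = 1.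
Proof.
move: u; apply: smallest_sub [set u | word_lift u = 1] _ _.
  split=> [|x y /= x1 y1|x /= x1]; first exact: (morph_one word_liftM).
    by rewrite word_liftM x1 y1 mulg1.
  by rewrite (morph_inv word_liftM) x1 invg1.
move=> _ [a Ka [b Kb <-]] /=.
rewrite /commg !conjgE !word_liftM !(morph_inv word_liftM).
have /= -> := wire_stars_normal_commute wireW (fun=> id)
  (word_lift_kernel Ka) (word_lift_kernel Kb).
by rewrite !gsimpl.
Qed.

Definition wire_lift (a : free_com_wire X) : W := word_lift (repr a).

Lemma wire_lift_class u : wire_lift (wire_class u) = word_lift u.
Proof.
apply: (@mulgI _ (word_lift u)^-1); rewrite -!(morph_inv word_liftM) -!word_liftM.
rewrite mulVg (morph_one word_liftM); apply: word_lift_kernel'.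
apply/wire_class_eq1.
by rewrite wire_classM wire_classV wire_class_repr mulVg.
Qed.

Lemma wire_liftM : {morph wire_lift : a b / a * b}.
Proof.
move=> a b; rewrite -(wire_class_repr a) -(wire_class_repr b) -wire_classM.
by rewrite !wire_lift_class word_liftM.
Qed.

Lemma wire_lift_circ a b :
  wire_lift (a \circ b) = op (wire_lift a) (wire_lift b).
Proof.
rewrite -(wire_class_repr a) -(wire_class_repr b) wire_class_circ.
by rewrite !wire_lift_class word_lift_circ_left.
Qed.

Lemma wire_lift_gen l : wire_lift (wire_class (free_gen l)) = g l.
Proof. by rewrite wire_lift_class /word_lift word_prod_gen. Qed.

End Lift.

(** * Joint faithfulness of the Magnus representations *)

Section Faithful.
Import GRing.Theory Num.Theory.

Lemma wire_kernel_normal : is_normal_subgroup (@wire_kernel X).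
Proof. exact: normal_closure_normal. Qed.

(** F/N is the group completion of Y, an abelian group, and supplies the vertices of the Cayley
    graph. *)
Definition wire_ab : Type := quotient_group wire_kernel_normal.
HB.instance Definition _ := Group.on wire_ab.

Definition ab_class u : wire_ab := quotient_class wire_kernel_normal u.
Implicit Types q r : wire_ab.

Lemma ab_classM : {morph ab_class : u v / u * v}.
Proof. by move=> u v; symmetry; exact: quotient_mulE. Qed.

Lemma ab_class_repr q : ab_class (repr q) = q.
Proof. exact: quotient_class_repr. Qed.

Lemma ab_class_gen m l :
  ab_class (free_gen (m \circ l)) =
  ab_class (free_gen m) * ab_class (free_gen l).
Proof.
rewrite -ab_classM; symmetry; apply/quotient_classP.
have [[_ _ KV] KJ] := wire_kernel_normal.
suff -> : (free_gen m * free_gen l)^-1 * free_gen (m \circ l) =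
    ((free_gen m)^-1 * free_gen (m \circ l) * (free_gen l)^-1) ^ free_gen l.
  by apply: KJ; apply: sub_gen_smallest; exists m, l.
by rewrite conjgE !gsimpl.
Qed.

(** Sending the empty multiset, which is not in Y, to 1 yields a monoid morphism on all
    multisets. *)
Definition mset_class (A : {mset {classic X}}%mset) : wire_ab :=
  if insub A is Some m then ab_class (free_gen m) else 1.

Lemma mset_class_val m : mset_class (val m) = ab_class (free_gen m).
Proof. by rewrite /mset_class valK. Qed.

Lemma mset_class0 : mset_class mset0 = 1.
Proof. by rewrite /mset_class insubF ?eqxx. Qed.

Lemma mset_classD A B :
  mset_class (A `+` B)%mset = mset_class A * mset_class B.
Proof.
have [->|A0] := eqVneq A mset0; first by rewrite mset0D mset_class0 mul1g.
have [->|B0] := eqVneq B mset0; first by rewrite msetD0 mset_class0 mulg1.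
have -> : A = val (exist _ A A0 : Y) by [].
have -> : B = val (exist _ B B0 : Y) by [].
rewrite !mset_class_val -ab_class_gen -mset_class_val.
by [].
Qed.

Lemma mset_class_commute A B : commute (mset_class A) (mset_class B).
Proof. by rewrite /commute -!mset_classD msetDC. Qed.

Lemma ab_class_frac q :
  exists A B, q = mset_class A * (mset_class B)^-1.
Proof.
rewrite -(ab_class_repr q) -(word_prod_id (repr q)) (morph_word_prod ab_classM).
elim: (word _) => [|[y b] w [A [B E]]].
  by exists mset0, mset0; rewrite /word_prod big_nil mulgV.
rewrite /word_prod big_cons -/(word_prod _ _) E /= -mset_class_val.
case: b; first by exists (val y `+` A)%mset, B; rewrite mset_classD !gsimpl.
exists A, (B `+` val y)%mset.
by rewrite mset_classD !gsimpl (commuteV (mset_class_commute _ _)).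
Qed.

Section Weight.
Variables (b : nat) (s : seq {classic X}).
Local Notation weight := (mset_weight b s).

Definition magnus_gen m : magnus :=
  (Posz (weight (val m)), ('X^(weight (val m)))%R).

Lemma magnus_gen_circ l m :
  magnus_gen (l \circ m) = magnus_circ (magnus_gen l) (magnus_gen m).
Proof. by rewrite /magnus_gen /magnus_circ mset_weightD PoszD exprD. Qed.

Definition magnus_rep u : magnus := word_lift magnus_gen u.

Lemma magnus_repM : {morph magnus_rep : u v / u * v}.
Proof. exact: word_liftM. Qed.

Lemma magnus_rep_gen m : magnus_rep (free_gen m) = magnus_gen m.
Proof. exact: word_prod_gen. Qed.

Lemma magnus_rep_neq0 u : ((magnus_rep u).2 != 0)%R.
Proof.
suff : ((magnus_rep u).2.[1] = 1)%R.
  by apply: contra_eq_neq => ->; rewrite horner0 eq_sym oner_neq0.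
have [S1 SM SV] := magnus_augmentation_subgroup.
have Sg m : ((magnus_gen m).2.[1] = 1)%R by rewrite hornerXn expr1n.
apply: (big_ind [set a : magnus | (a.2).[1] = 1]%R) => [|a c|[m []] _].
- exact: S1.
- exact: SM.
- exact: Sg.
- exact: (SV (magnus_gen m) (Sg m)).
Qed.

Definition ab_weight q : int := (magnus_rep (repr q)).1.

(** First components form a group morphism to the integers, and additivity of weights makes it kill
    the generators of N. *)
Lemma ab_weight_class u : ab_weight (ab_class u) = (magnus_rep u).1.
Proof.
have /quotient_classP : ab_class (repr (ab_class u)) = ab_class u.
  exact: ab_class_repr.
rewrite /ab_weight; set v := repr _ => Kuv.
suff : (magnus_rep (v^-1 * u)).1 = 0%R.
  by rewrite magnus_repM (morph_inv magnus_repM) /= addrC => /subr0_eq.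
move: (v^-1 * u) Kuv.
apply: smallest_sub [set w | (magnus_rep w).1 = 0]%R _ _; first split; first split.
- by rewrite /= (morph_one magnus_repM).
- by move=> x y /= x0 y0; rewrite magnus_repM /= x0 y0.
- by move=> x /= x0; rewrite (morph_inv magnus_repM) /= x0.
- move=> x g /= x0; rewrite conjgE !magnus_repM (morph_inv magnus_repM) /= x0.
  by rewrite add0r addNr.
move=> _ [m [l ->]] /=.
rewrite !magnus_repM !(morph_inv magnus_repM) /= !magnus_rep_gen /=.
by rewrite mset_weightD PoszD addKr subrr.
Qed.

Lemma ab_weightM q r : ab_weight (q * r) = (ab_weight q + ab_weight r)%R.
Proof.
by rewrite -(ab_class_repr q) -(ab_class_repr r) -ab_classM !ab_weight_class
  magnus_repM.
Qed.

Lemma ab_weightV q : ab_weight q^-1 = (- ab_weight q)%R.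
Proof.
by rewrite -(ab_class_repr q) -(morph_inv ab_classM) !ab_weight_class
  (morph_inv magnus_repM).
Qed.

Lemma ab_weight_mset A : ab_weight (mset_class A) = Posz (weight A).
Proof.
have [->|A0] := eqVneq A mset0.
  rewrite mset_class0 -(morph_one ab_classM) ab_weight_class.
  by rewrite (morph_one magnus_repM) mset_weight0.
have -> : A = val (exist _ A A0 : Y) by [].
by rewrite mset_class_val ab_weight_class magnus_rep_gen.
Qed.

(* The contribution of an edge of the Cayley graph of F/N to the Magnus       *)
(* representation of a word whose path traverses it.                          *)
Definition edge_weight (e : wire_ab * Y) : {poly laurent_field} :=
  (laurent_var ^ ab_weight e.1 *: ('X^(weight (val e.2)) - 1))%R.

End Weight.

(** With q = f q / g q, the elements q and r have equal weights exactly when the multisets f q + g r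
    and f r + g q do, so separating these cross sums is enough. *)
Lemma weights_separate (qs : seq wire_ab) (ms : seq {mset {classic X}}%mset) :
  exists b s, {in qs &, injective (ab_weight b s)} /\
              {in ms &, injective (mset_weight b s)}.
Proof.
have [f Hf] := choice (fun q => ab_class_frac q).
have [g Hg] := choice Hf.
have [b [s inj]] := mset_weight_separates
  (ms ++ [seq (f q `+` g r)%mset | q <- qs, r <- qs]).
exists b, s; split=> [q r qsq rsq|A A' msA msA']; last first.
  by apply: inj; rewrite mem_cat ?msA ?msA'.
have mem q' r' : q' \in qs -> r' \in qs -> (f q' `+` g r')%mset \in
    ms ++ [seq (f q1 `+` g r1)%mset | q1 <- qs, r1 <- qs].
  by move=> q'qs r'qs; rewrite mem_cat; apply/orP; right; apply/allpairsP;
    exists (q', r').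
rewrite (Hg q) (Hg r) !ab_weightM !ab_weightV !ab_weight_mset => /eqP.
rewrite subr_eq addrAC eq_sym subr_eq -!PoszD -!mset_weightD => /eqP[].
move/(inj _ _ (mem _ _ rsq qsq) (mem _ _ qsq rsq))/(congr1 mset_class).
rewrite !mset_classD => E; apply: (@mulIg _ (mset_class (g r))).
rewrite mulgVK -mulgA -(commuteV (mset_class_commute _ _)) mulgA.
by rewrite -?E ?mulgK // E mulgK.
Qed.

(** An edge is recorded by its source and label; an inverse letter read at [q] runs backwards along
    the edge ending at [q]. *)
Fixpoint cayley_path q (w : seq (Y * bool)) : seq ((wire_ab * Y) * bool) :=
  match w with
  | [::] => [::]
  | (y, true) :: w' =>
      (q, y, true) :: cayley_path (q * ab_class (free_gen y)) w'
  | (y, false) :: w' =>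
      let r := q * (ab_class (free_gen y))^-1 in
      (r, y, false) :: cayley_path r w'
  end.

(* The Schreier generator of N attached to an edge of the Cayley graph of F/N.*)
Definition schreier_gen (e : wire_ab * Y) : F :=
  repr e.1 * free_gen e.2 * (repr (e.1 * ab_class (free_gen e.2)))^-1.

Lemma schreier_gen_kernel e : wire_kernel (schreier_gen e).
Proof.
suff : ab_class 1 = ab_class (schreier_gen e).
  by move/quotient_classP; rewrite invg1 mul1g.
rewrite !ab_classM (morph_inv ab_classM) !ab_class_repr mulgV.
exact: morph_one ab_classM.
Qed.

(** Schreier rewriting: the coset representatives of consecutive vertices telescope. *)
Lemma word_prod_cayley_path q w : word_prod schreier_gen (cayley_path q w) =
  repr q * word_prod (@free_gen Y) w *
  (repr (q * ab_class (word_prod (@free_gen Y) w)))^-1.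
Proof.
elim: w q => [|[y []] w IH] q /=; rewrite /word_prod ?big_nil ?big_cons /=.
- by rewrite mulg1 (morph_one ab_classM) mulg1 mulgV.
- by rewrite -/(word_prod _ _) IH /schreier_gen ab_classM !gsimpl.
rewrite -!/(word_prod _ _) IH /schreier_gen ab_classM (morph_inv ab_classM) /=.
by rewrite mulgVK !gsimpl.
Qed.

(** Fox calculus: the letter y read at q adds z^(weight of q) (t^(weight of y) - 1), and y^-1
    subtracts the same expression taken at the source q y^-1. *)
Lemma magnus_rep_cayley_path b s q w :
  (laurent_var ^ ab_weight b s q *:
     ((word_prod (magnus_gen b s) w).2 - 1) =
  \sum_(a <- cayley_path q w)
     (if a.2 then edge_weight b s a.1 else - edge_weight b s a.1))%R.
Proof.
have wgt y : ab_weight b s (ab_class (free_gen y)) =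
    Posz (mset_weight b s (val y)).
  by rewrite -mset_class_val ab_weight_mset.
elim: w q => [|[y []] w IH] q; rewrite /word_prod ?big_nil ?big_cons /=.
- by rewrite subrr scaler0.
- rewrite -/(word_prod _ _) -IH ab_weightM wgt laurent_var_expzD.
  by rewrite /edge_weight -scalerA -scalerDr addrAC.
rewrite -/(word_prod _ _) -IH ab_weightM ab_weightV wgt laurent_var_expzD.
rewrite /edge_weight /= ab_weightM ab_weightV wgt laurent_var_expzD.
rewrite [(1 - _)%R]addrC [(_ + 1 + _)%R]addrAC addrK.
by rewrite scalerDr scalerN !scalerA.
Qed.

(** Once weights separate the finitely many sources and labels, the coefficient of t^(weight of y0)
    selects the edges labelled y0, and independence of the powers of z those with source q0; their
    signed count is 0. *)
Lemma edge_weights_balanced (E : seq ((wire_ab * Y) * bool)) :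
  (forall b s, \sum_(a <- E)
     (if a.2 then edge_weight b s a.1 else - edge_weight b s a.1) = 0)%R ->
  balanced E.
Proof.
move=> E0 [q0 y0].
(* Including [mset0] makes the weight of [y0] nonzero, so the constant terms -1 do not enter the
   coefficient extracted. *)
have [b [s [injq injy]]] := weights_separate
  (q0 :: [seq a.1.1 | a <- E]) (mset0 :: val y0 :: [seq val a.1.2 | a <- E]).
pose sgn (a : (wire_ab * Y) * bool) : int := (if a.2 then 1 else -1)%R.
pose c a : int := (sgn a * (a.1.2 == y0)%:R)%R.
pose k (a : (wire_ab * Y) * bool) := ab_weight b s a.1.1.
have : (\sum_(a <- E) (c a)%:~R * laurent_var ^ k a = 0)%R.
  have := congr1 (coefp (mset_weight b s (val y0))) (E0 b s).
  rewrite /= coef0 coef_sum => C; rewrite -[RHS]C; apply: eq_big_seq => -[[q y] d] aE.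
  have coef_edge : ((edge_weight b s (q, y))`_(mset_weight b s (val y0)) =
      (y == y0)%:R * laurent_var ^ ab_weight b s q)%R.
    rewrite coefZ coefB coefXn coef1 mulrC.
    have -> : (mset_weight b s (val y0) == 0)%N = false.
      rewrite -[X in _ == X](mset_weight0 b s) (inj_in_eq injy) ?inE ?eqxx ?orbT //.
      exact: negbTE (valP y0).
    rewrite subr0 (inj_in_eq injy) ?inE ?eqxx ?orbT // 1?eq_sym //.
    by rewrite (map_f (fun a : _ * bool => val a.1.2) aE) !orbT.
  rewrite /c /k /sgn /=; case: d {aE} => /=; rewrite ?coefN coef_edge.
    by rewrite mul1r; case: eqP => _; rewrite ?mul0r ?mul1r ?scale1r.
  rewrite mulN1r; case: eqP => _ /=; first by rewrite mulrNz mulNr mul1r.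
  by rewrite !(mul0r, oppr0).
move/laurent_var_indep => /(_ (ab_weight b s q0)) C.
have {C} : (\sum_(a <- E | a.1 == (q0, y0)) sgn a = 0)%R.
  rewrite -[RHS]C big_mkcond [RHS]big_mkcond.
  apply: eq_big_seq => -[[q y] d] aE /=.
  rewrite /k /c /= (inj_in_eq injq) ?inE ?eqxx //; last first.
    by rewrite (map_f (fun a : _ * bool => a.1.1) aE) orbT.
  rewrite xpair_eqE; case: eqP => //= _.
  by case: eqP => _; rewrite ?mulr1 ?mulr0.
have -> : (\sum_(a <- E | a.1 == (q0, y0)) sgn a =
    Posz (count_mem (q0, y0, true) E) - Posz (count_mem (q0, y0, false) E))%R.
  elim: E {E0 injq injy} => [|[e d] E IH]; first by rewrite big_nil.
  have pair_eq d' :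
    ((e, d) == (q0, y0, d')) = (e == (q0, y0)) && (d == d') by [].
  rewrite big_cons IH /= !pair_eq.
  case: (e == _); case: d {pair_eq}; rewrite /sgn /= ?add0n // PoszD ?addrA //.
  by rewrite opprD addrA [(-1 + _)%R]addrC.
by move/subr0_eq => -[].
Qed.

Lemma magnus_rep_faithful u :
  (forall b s, magnus_rep b s u = 1) -> wire_kernel' u.
Proof.
move=> u1; have cu1 : ab_class u = 1.
  have [b [s [inj _]]] := weights_separate [:: ab_class u; 1] [::].
  apply: inj; rewrite ?inE ?eqxx ?orbT //.
  rewrite -(morph_one ab_classM) !ab_weight_class.
  by rewrite (morph_one (magnus_repM _ _)) u1.
have P1 : wire_class (word_prod schreier_gen (cayley_path 1 (word u))) = 1.
  rewrite (morph_word_prod wire_classM); apply: word_prod_balanced.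
    move=> e e' /=; rewrite /commute -!wire_classM; symmetry.
    apply/(quotient_classP (wire_kernel'_normal X)).
    set g := schreier_gen e; set g' := schreier_gen e'.
    have -> : (g' * g)^-1 * (g * g') = [~ g, g'] by rewrite commgEl conjgE !gsimpl.
    apply: sub_gen_smallest; exists g; first exact: schreier_gen_kernel.
    by exists g'; first exact: schreier_gen_kernel.
  apply: edge_weights_balanced => b s; rewrite -magnus_rep_cayley_path.
  have -> : word_prod (magnus_gen b s) (word u) = 1 by exact: u1.
  by rewrite subrr scaler0.
apply/wire_class_eq1; move: P1.
(* The chosen representative of 1 may be a nontrivial element of N, so the path product is a
   conjugate of [u]. *)
rewrite word_prod_cayley_path word_prod_id cu1 mulg1 !wire_classM wire_classV.
move/divg1_eq => P1.
by apply: (@mulgI _ (wire_class (repr (1 : wire_ab)))); rewrite P1 mulg1.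
Qed.

Definition magnus_lift b s : free_com_wire X -> magnus :=
  wire_lift (magnus_gen b s).

Lemma magnus_liftM b s : {morph magnus_lift b s : a c / a * c}.
Proof. exact: (wire_liftM magnus_wire (magnus_gen_circ b s)). Qed.

Lemma magnus_lift_circ b s a c :
  magnus_lift b s (a \circ c) =
  magnus_circ (magnus_lift b s a) (magnus_lift b s c).
Proof. exact: (wire_lift_circ magnus_wire (magnus_gen_circ b s)). Qed.

Lemma magnus_lift_inj (a c : free_com_wire X) :
  (forall b s, magnus_lift b s a = magnus_lift b s c) -> a = c.
Proof.
move=> ac; apply: (@mulgI _ a^-1); rewrite mulVg; symmetry.
rewrite -(wire_class_repr (a^-1 * c)); apply/wire_class_eq1.
apply: magnus_rep_faithful => b s.
rewrite -[LHS]/(magnus_lift b s (a^-1 * c)) magnus_liftM.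
by rewrite (morph_inv (magnus_liftM b s)) ac mulVg.
Qed.

(** The wire identities hold for Magnus pairs and pass to F/N' by joint injectivity. *)
Lemma free_com_wire_wire : com_wire (@circ (free_com_wire X)).
Proof.
have [mA mC mD] := magnus_wire.
split=> [a c d|a c|a c d]; apply: magnus_lift_inj => b s.
- by rewrite !magnus_lift_circ mA.
- by rewrite !magnus_lift_circ mC.
by rewrite !(magnus_lift_circ, magnus_liftM, morph_inv (magnus_liftM b s)) mD.
Qed.

(* The polynomial of a Magnus pair takes the value 1 at 1, so it is not zero. *)
Lemma free_com_wire_circI (d : free_com_wire X) : injective (circ^~ d).
Proof.
move=> a c ac; apply: magnus_lift_inj => b s.
apply: (magnus_circI (magnus_rep_neq0 b s (repr d))).
by rewrite -![magnus_circ _ _]magnus_lift_circ ac.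
Qed.

End Faithful.

End FreeComWireTheory.

(** * Fractions *)

Section Fractions.
Variables (W : groupType) (op : W -> W -> W).
Hypotheses (wireW : com_wire op) (opI : forall c, injective (op^~ c)).
Local Notation "x ∘ y" := (op x y) (at level 40, left associativity).
Implicit Types a b c d u v w : W.

Let opA := com_wireA wireW.
Let opC := com_wireC wireW.

Let opAC := com_wireAC wireW.
Let opCA := com_wireCA wireW.
Let opACA := com_wireACA wireW.

Definition frac_eq (x y : W * W) : bool := x.1 ∘ y.2 == x.2 ∘ y.1.

(** Transitivity is where ∘-cancellation of the middle denominator enters. *)
Lemma frac_eq_equiv : equiv_class_of frac_eq.
Proof.
split=> [[u v]|[u v] [u1 v1]|[u1 v1] [u v] [u2 v2]]; rewrite /frac_eq /=.
- by rewrite opC.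
- by rewrite eq_sym opC (opC v1).
move=> /eqP E1 /eqP E2; apply/eqP/(@opI v1).
by rewrite opAC E1 -opA E2 (opC v1) opA.
Qed.

Canonical frac_eq_equiv_rel := EquivRelPack frac_eq_equiv.

Definition fractions : Type := {eq_quot frac_eq}.
HB.instance Definition _ := Choice.on fractions.
HB.instance Definition _ := Quotient.on fractions.
HB.instance Definition _ := EqQuotient.on fractions.
Implicit Types x y z : fractions.

Definition frac u v : fractions := \pi_fractions (u, v).

Lemma fracP u v u1 v1 : frac u v = frac u1 v1 <-> u ∘ v1 = v ∘ u1.
Proof.
split=> [/eqP|E]; first by rewrite eqmodE => /eqP.
by apply/eqP; rewrite eqmodE; apply/eqP.
Qed.

Lemma frac_repr x : frac (repr x).1 (repr x).2 = x.
Proof. by rewrite /frac -surjective_pairing reprK. Qed.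

Lemma frac_surj x : exists u v, x = frac u v.
Proof. by exists (repr x).1, (repr x).2; rewrite frac_repr. Qed.

Lemma frac_scale u v w : frac (u ∘ w) (v ∘ w) = frac u v.
Proof. by apply/fracP; rewrite opAC [RHS]opC opA. Qed.

Lemma frac_common3 x y z :
  exists a b c v, [/\ x = frac a v, y = frac b v & z = frac c v].
Proof.
have [[a [p ->]] [b [q ->]]] := (frac_surj x, frac_surj y).
have [c [r ->]] := frac_surj z.
exists (a ∘ (q ∘ r)), (b ∘ (p ∘ r)), (c ∘ (p ∘ q)), (p ∘ (q ∘ r)).
split; first by rewrite frac_scale.
  by rewrite [p ∘ (q ∘ r)]opCA frac_scale.
by rewrite [p ∘ (q ∘ r)]opA [_ ∘ r]opC frac_scale.
Qed.

Definition frac_mul x y : fractions :=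
  let (u, v) := repr x in let (u1, v1) := repr y in
  frac ((u ∘ v1) * (v ∘ v1)^-1 * (v ∘ u1)) (v ∘ v1).
Definition frac_circ x y : fractions :=
  frac ((repr x).1 ∘ (repr y).1) ((repr x).2 ∘ (repr y).2).
Definition frac_inv x : fractions :=
  frac ((repr x).2 * (repr x).1^-1 * (repr x).2) (repr x).2.
Definition frac_circ_inv x : fractions := frac (repr x).2 (repr x).1.
Definition frac_one : fractions := frac 1 1.

(** Cross-multiplication distributes over b c^-1 d, so the two numerators are compared term by
    term. *)
Lemma frac_mulE u v u1 v1 : frac_mul (frac u v) (frac u1 v1) =
  frac ((u ∘ v1) * (v ∘ v1)^-1 * (v ∘ u1)) (v ∘ v1).
Proof.
have /fracP := frac_repr (frac u v); have /fracP := frac_repr (frac u1 v1).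
rewrite /frac_mul; case: (repr _) => a1 b1; case: (repr _) => a b /= E1 E.
apply/fracP; rewrite (com_wire_heap wireW) (com_wire_heapl wireW).
congr (_ * _^-1 * _).
- by rewrite opACA E opACA.
by rewrite opACA E1 opACA.
Qed.

(** Over a common denominator the group axioms of the fractions reduce to group identities for u
    v^-1 w. *)
Lemma frac_mul_common u w v :
  frac_mul (frac u v) (frac w v) = frac (u * v^-1 * w) v.
Proof.
by rewrite frac_mulE (opC u v) -(com_wire_heap wireW) opC frac_scale.
Qed.

Lemma frac_circE u v u1 v1 :
  frac_circ (frac u v) (frac u1 v1) = frac (u ∘ u1) (v ∘ v1).
Proof.
have /fracP := frac_repr (frac u v); have /fracP := frac_repr (frac u1 v1).
rewrite /frac_circ; case: (repr _) => a1 b1; case: (repr _) => a b /= E1 E.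
by apply/fracP; rewrite opACA E E1 opACA.
Qed.

Lemma frac_invE u v : frac_inv (frac u v) = frac (v * u^-1 * v) v.
Proof.
have /fracP := frac_repr (frac u v).
rewrite /frac_inv; case: (repr _) => a b /= E.
apply/fracP; rewrite (com_wire_heap wireW) (com_wire_heapl wireW).
by rewrite E.
Qed.

Lemma frac_circ_invE u v : frac_circ_inv (frac u v) = frac v u.
Proof.
have /fracP := frac_repr (frac u v).
rewrite /frac_circ_inv; case: (repr _) => a b /= E.
by apply/fracP; rewrite -E.
Qed.

Lemma frac_oneE v : frac v v = frac_one.
Proof. by apply/fracP. Qed.

Fact frac_mulA : associative frac_mul.
Proof.
move=> x y z; have [a [b [c [v [-> -> ->]]]]] := frac_common3 x y z.
by rewrite !frac_mul_common !gsimpl.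
Qed.
Fact frac_mul1 : left_id frac_one frac_mul.
Proof.
move=> x; have [u [v ->]] := frac_surj x.
by rewrite -(frac_oneE v) frac_mul_common !gsimpl.
Qed.
Fact frac_mulx1 : right_id frac_one frac_mul.
Proof.
move=> x; have [u [v ->]] := frac_surj x.
by rewrite -(frac_oneE v) frac_mul_common !gsimpl.
Qed.
Fact frac_mulV : left_inverse frac_one frac_inv frac_mul.
Proof.
move=> x; have [u [v ->]] := frac_surj x.
by rewrite frac_invE frac_mul_common !gsimpl frac_oneE.
Qed.
Fact frac_mulxV : right_inverse frac_one frac_inv frac_mul.
Proof.
move=> x; have [u [v ->]] := frac_surj x.
by rewrite frac_invE frac_mul_common !gsimpl frac_oneE.
Qed.
HB.instance Definition _ := isGroup.Build fractions
  frac_mulA frac_mul1 frac_mulx1 frac_mulV frac_mulxV.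

HB.instance Definition _ := hasCirc.Build fractions frac_circ.

Fact frac_circA : associative frac_circ.
Proof.
move=> x y z; have [a [b [c [v [-> -> ->]]]]] := frac_common3 x y z.
by rewrite !frac_circE !opA.
Qed.
Fact frac_circC : commutative frac_circ.
Proof.
move=> x y; have [a [b [_ [v [-> -> _]]]]] := frac_common3 x y y.
by rewrite !frac_circE opC.
Qed.
Fact frac_circ1 : left_id frac_one frac_circ.
Proof.
move=> x; have [u [v ->]] := frac_surj x.
by rewrite frac_circE !(com_wire1x wireW).
Qed.
Fact frac_circx1 : right_id frac_one frac_circ.
Proof. by move=> x; rewrite frac_circC frac_circ1. Qed.
Fact frac_circV : left_inverse frac_one frac_circ_inv frac_circ.
Proof.
move=> x; have [u [v ->]] := frac_surj x.
by rewrite frac_circ_invE frac_circE opC frac_oneE.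
Qed.
Fact frac_circxV : right_inverse frac_one frac_circ_inv frac_circ.
Proof. by move=> x; rewrite frac_circC frac_circV. Qed.
Fact frac_circ_mulr x y z :
  frac_circ x (y * z) = frac_circ x y * x^-1 * frac_circ x z.
Proof.
have [a [b [c [v [-> -> ->]]]]] := frac_common3 x y z.
(* The inverse is put over [v ∘ v], the denominator of the two ∘-products beside it. *)
have -> : (frac a v)^-1 = frac (v ∘ v * (a ∘ v)^-1 * (v ∘ v)) (v ∘ v).
  by rewrite -(frac_scale a v v); exact: frac_invE.
rewrite -[_ * frac c v]/(frac_mul _ _) -![_ * _ in RHS]/(frac_mul _ _).
rewrite frac_mul_common !frac_circE !frac_mul_common (com_wire_heap wireW).
by rewrite !gsimpl.
Qed.
HB.instance Definition _ := isSkewBrace.Build fractions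
  frac_circA frac_circ1 frac_circx1 frac_circV frac_circxV frac_circ_mulr.
HB.instance Definition _ := SkewBrace_isCommutative.Build fractions frac_circC.

End Fractions.

(** * The universal property of the fractions *)

Lemma free_com_semigroup_ind (X : Type) (P : free_com_semigroup X -> Prop) :
  (forall x, P (com_semigroup_gen x)) ->
  (forall x m, P m -> P (com_semigroup_gen x \circ m)) -> forall m, P m.
Proof.
move=> Pgen Pcirc m0; have := esym (seq_mset_id (val m0)).
move: (enum_mset _) => s; elim: s m0 => [|x s IH] m E.
  have /eqP[] := valP m; rewrite E; apply/msetP => x.
  by rewrite mset_seqE mset0E.
have {}E : val m = ([mset x] `+` seq_mset s)%mset.
  by rewrite E; apply/msetP => y; rewrite mset1DE !mset_seqE /= eq_sym.
have [s0|s0] := eqVneq (seq_mset s) mset0.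
  suff -> : m = com_semigroup_gen (x : X) by exact: Pgen.
  by apply: val_inj; rewrite E s0 msetD0.
suff -> : m = com_semigroup_gen (x : X) \circ exist _ (seq_mset s) s0.
  by apply/Pcirc/IH.
by apply: val_inj; rewrite E.
Qed.

Section UniversalProperty.
Variables (X : Type) (B : comSkewBraceType) (f : X -> B).
Local Notation Y := (free_com_semigroup X).
Local Notation S := (fractions (free_com_wire_wire X) (@free_com_wire_circI X)).
Local Notation frac := (frac (free_com_wire_wire X) (@free_com_wire_circI X)).
Let wireX := free_com_wire_wire X.

Lemma com_skew_brace_wire : com_wire (@circ B).
Proof. split; [exact: circA | exact: circC | exact: circ_mulr]. Qed.
Let wireB := com_skew_brace_wire.

HB.instance Definition _ := Monoid.isComLaw.Build B 1 (@circ B)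
  circA circC (com_wire1x com_skew_brace_wire).

Lemma com_skew_brace_circI (c : B) : injective (circ^~ c).
Proof.
move=> a b /(congr1 (circ^~ (circ_inv c))).
by rewrite -!circA circxV !circx1.
Qed.

Definition semigroup_lift (m : Y) : B :=
  \big[@circ B/1]_(x <- enum_mset (val m)) f x.

Lemma semigroup_lift_circ l m :
  semigroup_lift (l \circ m) = semigroup_lift l \circ semigroup_lift m.
Proof.
rewrite /semigroup_lift -big_cat; apply: perm_big; apply/allP => x _ /=.
by rewrite count_cat !count_mem_mset msetE2.
Qed.

Lemma semigroup_lift_gen x : semigroup_lift (com_semigroup_gen x) = f x.
Proof. by rewrite /semigroup_lift enum_msetn big_seq1. Qed.

Definition free_wire_lift : free_com_wire X -> B := wire_lift semigroup_lift.
Local Notation phi := free_wire_lift.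

Lemma free_wire_liftM : {morph phi : a b / a * b}.
Proof. exact: (wire_liftM wireB semigroup_lift_circ). Qed.

Lemma free_wire_lift_circ : {morph phi : a b / a \circ b}.
Proof. exact: (wire_lift_circ wireB semigroup_lift_circ). Qed.

Lemma free_wire_lift_gen x : phi (wire_gen x) = f x.
Proof.
rewrite /phi (wire_lift_gen wireB semigroup_lift_circ).
exact: semigroup_lift_gen.
Qed.

Lemma free_wire_lift_unique (psi : free_com_wire X -> B) :
  {morph psi : a b / a * b} -> {morph psi : a b / a \circ b} ->
  (forall x, psi (wire_gen x) = f x) -> psi =1 phi.
Proof.
move=> psiM psi_circ psi_gen a.
(* On generators ∘ restricts to the operation of Y, so [psi] is determined on Y by induction from
   X. *)
have gen_circ (l m : Y) : wire_class (free_gen (l \circ m)) =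
    wire_class (free_gen l) \circ wire_class (free_gen m) :> free_com_wire X.
  rewrite wire_class_circ; congr wire_class.
  rewrite /circ_left /circ_letter /word_prod !big_seq1 /=.
  by rewrite !gsimpl.
rewrite -(wire_class_repr a) -(word_prod_id (repr a)).
rewrite !(morph_word_prod (@wire_classM X)) (morph_word_prod psiM).
rewrite (morph_word_prod free_wire_liftM); apply: eq_word_prod.
apply: free_com_semigroup_ind => [x|x m IH] /=.
  by rewrite [LHS]psi_gen -[RHS]/(phi (wire_gen x)) free_wire_lift_gen.
rewrite /= gen_circ psi_circ free_wire_lift_circ; congr circ => //.
by rewrite [LHS]psi_gen -[RHS]/(phi (wire_gen x)) free_wire_lift_gen.
Qed.

Definition frac_lift (s : S) : B :=
  phi (repr s).1 \circ circ_inv (phi (repr s).2).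

(** With the denominator cleared, identities in [B] can be checked after ∘-multiplication by
    [phi v], which cancels. *)
Lemma frac_liftE u v : frac_lift (frac u v) \circ phi v = phi u.
Proof.
have /fracP := frac_repr (frac u v).
rewrite /frac_lift; case: (repr _) => a b /= E.
apply: (@com_skew_brace_circI (phi b)).
rewrite (com_wireAC wireB (phi a)) -(circA (phi a \circ phi v)) circVx circx1.
by rewrite -!free_wire_lift_circ E (com_wireC wireX).
Qed.

Lemma frac_lift_morphism : skew_brace_morphism frac_lift.
Proof.
split=> s t; have [u [w [_ [v [-> -> _]]]]] := frac_common3 s t t.
  apply: (@com_skew_brace_circI (phi v)).
  rewrite [frac u v * _]frac_mul_common frac_liftE !free_wire_liftM.
  rewrite (morph_inv free_wire_liftM) (com_wireDl wireB) !frac_liftE.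
  by [].
apply: (@com_skew_brace_circI (phi (v \circ v))).
rewrite [frac u v \circ _]frac_circE frac_liftE !free_wire_lift_circ.
by rewrite (com_wireACA wireB) !frac_liftE.
Qed.

Lemma frac_lift_gen x : frac_lift (frac (wire_gen x) 1) = f x.
Proof.
rewrite -(com_wirex1 wireB (frac_lift _)) -(morph_one free_wire_liftM).
by rewrite frac_liftE free_wire_lift_gen.
Qed.

Lemma frac_lift_unique (h : S -> B) : skew_brace_morphism h ->
  (forall x, h (frac (wire_gen x) 1) = f x) -> h =1 frac_lift.
Proof.
move=> [hM hcirc] hgen s; have [u [v ->]] := frac_surj s.
(* Restricted to fractions w/1, [h] is a wire morphism, hence [phi]; then u/v ∘ v/1 = u/1 determines
   [h] everywhere. *)
have hphi w : h (frac w 1) = phi w.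
  apply: (free_wire_lift_unique (psi := fun w => h (frac w 1))) => [a b|a b|//].
    rewrite -hM [_ * _ in RHS]frac_mulE !(com_wirex1 wireX, com_wire1x wireX).
    by rewrite invg1 mulg1.
  by rewrite -hcirc [_ \circ _ in RHS]frac_circE (com_wirex1 wireX).
apply: (@com_skew_brace_circI (phi v)); rewrite frac_liftE -!hphi -hcirc.
congr h; rewrite [_ \circ _]frac_circE; apply/fracP.
by rewrite !(com_wirex1 wireX) (com_wireC wireX).
Qed.

End UniversalProperty.

Theorem theorem4p23 (X : Type) :
  exists (S : comSkewBraceType)
         (frac : free_com_wire X -> free_com_wire X -> S),
    [/\ forall s : S, exists u v : free_com_wire X, s = frac u v,
        forall u v u1 v1 : free_com_wire X,
          frac u v = frac u1 v1 <-> u \circ v1 = v \circ u1,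
        forall u v u1 v1 : free_com_wire X,
          frac u v * frac u1 v1 =
          frac ((u \circ v1) * (v \circ v1)^-1 * (v \circ u1)) (v \circ v1),
        forall u v u1 v1 : free_com_wire X,
          frac u v \circ frac u1 v1 = frac (u \circ u1) (v \circ v1)
      & free_com_skew_brace (fun x : X => frac (wire_gen x) 1)].
Proof.
exists (fractions (free_com_wire_wire X) (@free_com_wire_circI X)).
exists (frac (free_com_wire_wire X) (@free_com_wire_circI X)); split.
- exact: frac_surj.
- exact: fracP.
- exact: frac_mulE.
- exact: frac_circE.
move=> B f; exists (frac_lift f); split=> [|h [hM hf]].
  split=> [|x]; first exact: frac_lift_morphism.
  by rewrite frac_lift_gen.
by apply/funext => s; rewrite (frac_lift_unique (f := f) hM).
Qed.
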